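(* Let $h>0$, $a,b\in h\mathbb{Z}$ with $a<b$, $\mathbb{T}=[a,b]\cap h\mathbb{Z}$, $\alpha,\beta\in(0,1]$, $\gamma=1-\alpha$, $\nu=1-\beta$. Let $L(t,u,v,w):\mathbb{T}^\kappa\times\mathbb{R}^3\to\mathbb{R}$ be such that the second-order partial derivatives $L_{uu},L_{uv},L_{uw},L_{vw},L_{vv},L_{ww}$ exist and are continuous, and let $A,B\in\mathbb{R}$. If $\hat y\in\mathcal{F}_{\mathbb{T}}$ is a local minimum for the problem $$\mathcal{L}[y(\cdot)]=\int_{a}^{b}L\bigl(t,y^{\sigma}(t),{_a}\Delta_h^\alpha y(t),{_h}\Delta_b^\beta y(t)\bigr)\Delta t\longrightarrow\min,\quad y(a)=A,\ y(b)=B,$$ then the inequality $$\begin{aligned} h^2&L_{uu}[\hat y](t)+2h^{\gamma+1}L_{uv}[\hat y](t)+2h^{\nu+1}(\nu-1)L_{uw}[\hat y](t)+h^{2\gamma}(\gamma-1)^2L_{vv}[\hat y](\sigma(t))\\ &+2h^{\nu+\gamma}(\gamma-1)L_{vw}[\hat y](\sigma(t))+2h^{\nu+\gamma}(\nu-1)L_{vw}[\hat y](t)+h^{2\nu}(\nu-1)^2L_{ww}[\hat y](t)\\ &+h^{2\nu}L_{ww}[\hat y](\sigma(t))+\int_a^t h^3L_{ww}[\hat y](s)\left(\frac{\nu(1-\nu)}{\Gamma(\nu+1)}(t+\nu h-\sigma(s))_h^{(\nu-2)}\right)^2\Delta s\\ &+h^{\gamma}L_{vv}[\hat y](t)+\int_{\sigma(\sigma(t))}^b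 h^3L_{vv}[\hat y](s)\left(\frac{\gamma(\gamma-1)}{\Gamma(\gamma+1)}(s+\gamma h-\sigma(\sigma(t)))_h^{(\gamma-2)}\right)^2\Delta s\ \ge 0 \end{aligned}$$ holds for all $t\in\mathbb{T}^{\kappa^2}$, where $[\hat y](t)=(t,\hat y^\sigma(t),{_a}\Delta_h^\alpha\hat y(t),{_h}\Delta_b^\beta\hat y(t))$.
   Context: $\sigma(t)=t+h$, $f^\sigma(t)=f(\sigma(t))$, $f^\Delta(t)=(f(t+h)-f(t))/h$, $\int_c^d f(t)\Delta t=\sum_{k=c/h}^{d/h-1}f(kh)h$ (empty sums are zero). $\mathbb{T}^\kappa=[a,b-h]\cap h\mathbb{Z}$, $\mathbb{T}^{\kappa^2}=[a,b-2h]\cap h\mathbb{Z}$. $\mathcal{F}_{\mathbb{T}}$ is the set of real-valued functions on $\mathbb{T}$. $\Gamma$ is the Euler gamma function, and the $h$-factorial is $x_h^{(y)}=h^y\Gamma(\frac{x}{h}+1)/\Gamma(\frac{x}{h}+1-y)$ (division at a pole yields zero). For $r>0$, the left and right fractional $h$-sums of order $r$, evaluated at shifted points, are $${_a}\Delta_h^{-r}f(t+r h)=\frac{1}{\Gamma(r)}\sum_{k=a/h}^{t/h}(t+r h-\sigma(kh))_h^{(r-1)}f(kh)h,$$ $${_h}\Delta_b^{-r}f(t-r h)=\frac{1}{\Gamma(r)}\sum_{k=t/h}^{b/h}(kh+r h-\sigma(t))_h^{(r-1)}f(kh)h,$$ and for $r=0$ both are $f(t)$. The left fractional difference of order $\alpha\in(0,1]$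 is ${_a}\Delta_h^{\alpha}f(t)=({_a}\Delta_h^{-\gamma}f(t+\gamma h))^\Delta$ with $\gamma=1-\alpha$, and the right fractional difference of order $\beta\in(0,1]$ is ${_h}\Delta_b^{\beta}f(t)=-({_h}\Delta_b^{-\nu}f(t-\nu h))^\Delta$ with $\nu=1-\beta$, for $t\in\mathbb{T}^\kappa$, where $\Delta$ acts on $t$. Subscripts $u,v,w$ on $L$ denote partial derivatives with respect to the second, third and fourth arguments, and e.g. $L_{vv}[\hat y](t)=L_{vv}([\hat y](t))$. A function $\hat y\in\mathcal{F}_{\mathbb{T}}$ with $\hat y(a)=A$, $\hat y(b)=B$ is a local minimum for the problem if there is $\delta>0$ with $\mathcal{L}[\hat y]\le\mathcal{L}[y]$ for all $y\in\mathcal{F}_{\mathbb{T}}$ with $y(a)=A$, $y(b)=B$ and $\|y-\hat y\|<\delta$, where $\|f\|=\max_{t\in\mathbb{T}^\kappa}|f^\sigma(t)|+\max_{t\in\mathbb{T}^\kappa}|{_a}\Delta_h^\alpha f(t)|+\max_{t\in\mathbb{T}^\kappa}|{_h}\Delta_b^\beta f(t)|$.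
   Formalization: The term $h^{\gamma}L_{vv}[\hat y](t)$ is corrected to $h^{2\gamma}L_{vv}[\hat y](t)$; as printed the inequality fails, e.g. for $h=1/4$, $a=0$, $b=2h$, $\alpha=1/2$, $\beta=1$, $A=B=0$, $\hat y=0$, $L(0,\cdot)=2u^2-v^2/2$, $L(h,\cdot)=0$. *)

(* Defs.v *)
From HB Require Import structures.
From mathcomp Require Import all_boot all_order all_algebra.
From mathcomp Require Import all_classical all_reals all_analysis.

Set Implicit Arguments.
Unset Strict Implicit.
Unset Printing Implicit Defensive.
Import Order.TTheory GRing.Theory Num.Theory.
Import numFieldNormedType.Exports.

Local Open Scope classical_set_scope.
Local Open Scope ring_scope.

Section gamma.
Context {R : realType}.

Definition gamma_integral (x : R) : R :=
  \int[lebesgue_measure]_(t in `]0, +oo[) (t `^ (x - 1) * expR (- t)).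

(* For x <= 0 we use Gamma x = Gamma (x + n) / (x (x+1) ... (x+n-1)), where n
   is the least natural number with 0 < x + n.  At a pole (x = 0, -1, -2, ...)
   the product vanishes, so Gamma x = 0 and dividing by Gamma x yields 0. *)
Definition Gamma (x : R) : R :=
  if 0 < x then gamma_integral x
  else let n := (Num.truncn (- x)).+1 in
       gamma_integral (x + n%:R) / \prod_(i < n) (x + i%:R).

End gamma.

(* Functions on a time scale are represented by total functions R -> R; their
   values outside [a,b] /\ hZ are never used by the definitions below. *)
Section h_calculus.
Context {R : realType}.
Implicit Types (h a b c d r t x y : R) (f : R -> R).

Definition hZ h : set R := [set t | exists k : int, t = k%:~R * h].

Definition hinterval h c d : set R := [set t | hZ h t /\ c <= t <= d].

Definition Tkappa h a b : set R := hinterval h a (b - h).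

Definition Tkappa2 h a b : set R := hinterval h a (b - 2 * h).

Definition sigma h t : R := t + h.

Definition hdelta h f t : R := (f (sigma h t) - f t) / h.

Definition hint h c d f : R :=
  \sum_(k \in [set k : int | c / h <= k%:~R <= d / h - 1])
    (f (k%:~R * h) * h).

Definition hfact h x y : R :=
  h `^ y * Gamma (x / h + 1) / Gamma (x / h + 1 - y).

(* The value at t + r h of the left fractional h-sum of order r. *)
Definition left_hsum h a r f t : R :=
  if r == 0 then f t
  else (Gamma r)^-1 *
    \sum_(k \in [set k : int | a / h <= k%:~R <= t / h])
      (hfact h (t + r * h - sigma h (k%:~R * h)) (r - 1) * f (k%:~R * h) * h).

(* The value at t - r h of the right fractional h-sum of order r. *)
Definition right_hsum h b r f t : R :=
  if r == 0 then f t
  else (Gamma r)^-1 *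
    \sum_(k \in [set k : int | t / h <= k%:~R <= b / h])
      (hfact h (k%:~R * h + r * h - sigma h t) (r - 1) * f (k%:~R * h) * h).

Definition left_hdiff h a alpha f : R -> R :=
  hdelta h (left_hsum h a (1 - alpha) f).

Definition right_hdiff h b beta f (t : R) : R :=
  - hdelta h (right_hsum h b (1 - beta) f) t.

End h_calculus.

Section partial_derivatives.
Context {R : realType}.
Implicit Types F : R -> R -> R -> R.

Definition pu F (u v w : R) : R := derive1 (fun x : R => F x v w) u.
Definition pv F (u v w : R) : R := derive1 (fun x : R => F u x w) v.
Definition pw F (u v w : R) : R := derive1 (fun x : R => F u v x) w.

Definition ex_pu F : Prop :=
  forall u v w : R, derivable (fun x : R => F x v w) u 1.
Definition ex_pv F : Prop :=
  forall u v w : R, derivable (fun x : R => F u x w) v 1.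
Definition ex_pw F : Prop :=
  forall u v w : R, derivable (fun x : R => F u v x) w 1.

Definition continuous3 F : Prop :=
  continuous (fun p : R * R * R => F p.1.1 p.1.2 p.2).

(* F_uv is read as (F_u)_v, and similarly for F_uw and F_vw. *)
Definition second_order_C F : Prop :=
  [/\ ex_pu F, ex_pv F & ex_pw F] /\
  [/\ ex_pu (pu F), ex_pv (pu F) & ex_pw (pu F)] /\
  [/\ ex_pv (pv F), ex_pw (pv F) & ex_pw (pw F)] /\
  [/\ continuous3 (pu (pu F)), continuous3 (pv (pu F)) &
      continuous3 (pw (pu F))] /\
  [/\ continuous3 (pv (pv F)), continuous3 (pw (pv F)) &
      continuous3 (pw (pw F))].

End partial_derivatives.

Section variational_problem.
Context {R : realType} (h a b alpha beta : R).
Implicit Types (L : R -> R -> R -> R -> R) (y f : R -> R).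

(* L([y](t)) *)
Definition along L y t : R :=
  L t (y (sigma h t)) (left_hdiff h a alpha y t) (right_hdiff h b beta y t).

Definition functional L y : R := hint h a b (along L y).

(* T^kappa is finite and nonempty, so the supremum is a maximum. *)
Definition max_Tkappa f : R := sup [set `|f t| | t in Tkappa h a b].

Definition hnorm f : R :=
  max_Tkappa (f \o sigma h) + max_Tkappa (left_hdiff h a alpha f)
  + max_Tkappa (right_hdiff h b beta f).

Definition local_minimum L (A B : R) (yhat : R -> R) : Prop :=
  [/\ yhat a = A, yhat b = B &
    exists2 delta : R, 0 < delta &
      forall y, y a = A -> y b = B -> hnorm (y \- yhat) < delta ->
        functional L yhat <= functional L y].

End variational_problem.

(* Main.v *)
Require Import Defs.
From HB Require Import structures.
From mathcomp Require Import all_boot all_order all_algebra.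
From mathcomp Require Import all_classical all_reals all_analysis.
From mathcomp Require Import measurable_realfun.
From mathcomp Require Import ring lra zify.
Import Order.TTheory GRing.Theory Num.Theory.
Import numFieldNormedType.Exports.
Local Open Scope classical_set_scope.
Local Open Scope ring_scope.

(** The inequality is the Legendre-type condition that the second variation of
    the functional is nonnegative, evaluated on one variation: the spike eta
    equal to h at sigma t and to 0 elsewhere.

    Along yhat + e * eta the functional is
      C + e * l + e^2 / 2 * q e
    where q e tends, as e tends to 0, to the second variation
    Sum_s h * Q_s(eta^sigma s, left difference s, right difference s), with Q_s
    the Hessian form of L(s, .) at [yhat](s) ([functional_expansion]).  Since
    hnorm (e * eta) <= |e| * M, local minimality makes e = 0 a local minimum of
    this function, and comparing e with -e removes the linear term, so that the
    second variation is nonnegative ([second_variation_ge0]).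

    The fractional sums of the spike are explicit: up to a power of h they are
    the coefficients c_n = r (r + 1) ... (r + n - 1) / n! of (1 - z)^(-r)
    ([left_hsum_spike], [right_hsum_spike]), because the kernel at distance n h
    is h^(r - 1) Gamma (r + n) / (Gamma r * n!) and the functional equation of
    Gamma turns the quotient into a product.  Consequently the left difference
    of the spike vanishes before t, takes the values h^gamma and
    h^gamma (gamma - 1) at t and sigma t, and h^gamma (c_(j+2) - c_(j+1)) at the
    points beyond; the right difference is the mirror image, vanishing after
    sigma t.
    Telescoping c_(j+2) - c_(j+1) gives back a single factorial function of
    order r - 2 ([hfact_hsum_coefB]).  Thus Lww alone contributes before t, Lvv
    alone after sigma t, and the two middle points give the remaining terms
    ([second_variation_before], [second_variation_after],
    [second_variation_at], [second_variation_at_sigma]). *)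

(** * The Euler gamma function *)

Section gamma_function.
Context {R : realType}.
Notation mu := lebesgue_measure.
Implicit Types x t : R.

Definition gamma_integrand x t : R := t `^ (x - 1) * expR (- t).

(** The extended-real version of [gamma_integral], so that monotone
    convergence applies before finiteness is known. *)
Definition gamma_eintegral x : \bar R :=
  (\int[mu]_(t in `]0%R, +oo[) (gamma_integrand x t)%:E)%E.

Lemma gamma_integrand_ge0 x t : 0 <= gamma_integrand x t.
Proof. by rewrite mulr_ge0 ?powR_ge0 ?expR_ge0. Qed.

Lemma measurable_gamma_integrand x (D : set R) :
  measurable_fun D (EFin \o gamma_integrand x : R -> \bar R).
Proof.
apply/measurable_EFinP; apply: (@measurable_funS _ _ _ _ setT) => //.
apply: measurable_funM; first exact: measurable_powR.
by apply: measurableT_comp; [exact: measurable_expR|exact: oppr_measurable].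
Qed.

(** Compact intervals avoiding 0, where the integrand may be singular, so that
    integration by parts applies on each of them. *)
Definition exhausting_itv (n : nat) : set R := `[n.+1%:R^-1, n.+2%:R].

Lemma exhausting_itv_lt (n : nat) : n.+1%:R^-1 < n.+2%:R :> R.
Proof.
have n1 : (1 : R) <= n.+1%:R by rewrite ler1n.
apply: (@le_lt_trans _ _ 1); first by rewrite invf_le1 // ltr0n.
by rewrite ltr1n.
Qed.

Lemma exhausting_itv_nondecreasing : nondecreasing_seq exhausting_itv.
Proof.
move=> m n mn; rewrite subsetEset => t /=.
rewrite /exhausting_itv /= !in_itv /= => /andP[mt tm]; apply/andP; split.
  by apply: le_trans mt; rewrite lef_pV2 ?posrE ?ltr0n // ler_nat.
by apply: (le_trans tm); rewrite ler_nat.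
Qed.

Lemma exhausting_itv_bigcup : \bigcup_n exhausting_itv n = `]0%R, +oo[%classic.
Proof.
apply/seteqP; split => t /=.
  move=> [n _]; rewrite /exhausting_itv /= !in_itv /= andbT => /andP[nt _].
  by apply: lt_le_trans nt; rewrite invr_gt0 ltr0n.
rewrite in_itv /= andbT => t0.
set m := maxn (Num.truncn t) (Num.truncn t^-1); exists m => //.
rewrite /exhausting_itv /= in_itv /=; apply/andP; split.
  rewrite invf_ple ?posrE ?ltr0n //; apply/ltW.
  apply: (lt_le_trans (truncnS_gt t^-1)).
  by rewrite ler_nat ltnS leq_maxr.
apply/ltW/(lt_le_trans (truncnS_gt t)).
by rewrite ler_nat ltnS (leq_trans (leq_maxl _ (Num.truncn t^-1))).
Qed.

Lemma gamma_eintegral_cvg x :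
  (\int[mu]_(t in exhausting_itv n) (gamma_integrand x t)%:E)%E @[n --> \oo]
    --> gamma_eintegral x.
Proof.
rewrite /gamma_eintegral -exhausting_itv_bigcup.
apply: ge0_nondecreasing_set_cvg_integral.
- exact: exhausting_itv_nondecreasing.
- by move=> n; exact: measurable_itv.
- by move=> n; exact: measurable_gamma_integrand.
- by move=> n t _; rewrite lee_fin gamma_integrand_ge0.
Qed.

(** With k a natural number above x, t^x <= t^k and
    e^t = (e^(t / (k+1)))^(k+1) >= (t / (k+1))^(k+1), which leaves a multiple of
    1 / t. *)
Lemma powR_expRN_cvg0 x :
  n.+2%:R `^ x * expR (- n.+2%:R) @[n --> \oo] --> (0 : R).
Proof.
set k := (Num.truncn x).+1.
have le_k t : 1 <= t -> t `^ x * expR (- t) <= k.+1%:R ^+ k.+1 / t.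
  move=> t1; have t0 : 0 < t by apply: lt_le_trans t1.
  have -> : expR (- t) = (expR (t / k.+1%:R) ^+ k.+1)^-1.
    by rewrite -expRM_natl -mulrC divfK ?pnatr_eq0 // expRN.
  rewrite ler_pdivrMr ?exprn_gt0 ?expR_gt0 //.
  have tx : t `^ x <= t ^+ k.
    rewrite -powR_mulrn ?(ltW t0) //; apply: ler_powR => //.
    exact/ltW/truncnS_gt.
  apply: (le_trans tx); rewrite -mulrA mulrC -mulrA -ler_pdivrMl //; last first.
    by rewrite invr_gt0.
  rewrite invrK -exprS mulrC -ler_pdivrMl ?exprn_gt0 ?ltr0n //.
  rewrite mulrC -exprVn -exprMn lerXn2r ?nnegrE ?expR_ge0 //.
    by rewrite mulr_ge0 ?invr_ge0 ?ler0n // ltW.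
  by apply: le_trans (expR_ge1Dx _); rewrite lerDr.
apply: (@squeeze_cvgr _ _ _ _ (fun=> 0) (fun n => k.+1%:R ^+ k.+1 * n.+2%:R^-1)).
- apply: nearW => n; rewrite mulr_ge0 ?powR_ge0 ?expR_ge0 //=.
  by apply: le_k; rewrite ler1n.
- exact: cvg_cst.
- rewrite -[X in _ --> X](mulr0 (k.+1%:R ^+ k.+1)); apply: cvgM; first exact: cvg_cst.
  have := @cvg_harmonic R; rewrite -(cvg_shiftn 1).
  by under eq_fun do rewrite /= addn1.
Qed.

Lemma powR_expRN_inv_cvg0 x : 0 < x ->
  n.+1%:R^-1 `^ x * expR (- n.+1%:R^-1) @[n --> \oo] --> (0 : R).
Proof.
move=> x0.
rewrite -[X in _ --> X](mul0r (expR (- 0))); apply: cvgM.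
  apply: (@cvg_comp _ _ _ (fun n => n.+1%:R^-1) (fun t : R => t `^ x) _ (0^'+)).
    move=> P [e /= e0 H]; have [N _ NP] := cvgr_lt _ (@cvg_harmonic R) _ e0.
    exists N => //= n /NP /= Hn; apply: H => /=; rewrite ?invr_gt0 ?ltr0n //.
    by rewrite sub0r normrN gtr0_norm // ?invr_gt0 ?ltr0n.
  exact: powR_cvg0.
apply: (@cvg_comp _ _ _ (fun n => n.+1%:R^-1) (fun t : R => expR (- t)) _ (nbhs 0)).
  exact: cvg_harmonic.
by apply: continuous_comp; [exact: continuousN|exact: continuous_expR].
Qed.

Lemma gamma_by_parts x (n : nat) : 0 < x ->
  (\int[mu]_(t in exhausting_itv n) (gamma_integrand (x + 1) t)%:E =
   (n.+1%:R^-1 `^ x * expR (- n.+1%:R^-1) - n.+2%:R `^ x * expR (- n.+2%:R))%:E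
   + x%:E * \int[mu]_(t in exhausting_itv n) (gamma_integrand x t)%:E)%E.
Proof.
move=> x0; have ab := exhausting_itv_lt n.
set a : R := n.+1%:R^-1 in ab *; set b : R := n.+2%:R in ab *.
have a0 : 0 < a by rewrite invr_gt0 ltr0n.
have dF t : 0 < t -> is_derive t 1 (fun s : R => s `^ x) (x * t `^ (x - 1)).
  by move=> t0; exact: is_derive1_powR.
have dG t : is_derive t 1 (fun s : R => - expR (- s)) (expR (- t)).
  by apply: is_derive_eq; rewrite mulrN1 opprK.
have cpow (y : R) t : 0 < t -> {for t, continuous (fun s : R => s `^ y)}.
  move=> t0; apply: differentiable_continuous; apply/derivable1_diffP.
  by apply: derivable_powR; rewrite in_itv /= t0.
have cG t : {for t, continuous (fun s : R => - expR (- s))}.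
  by apply: differentiable_continuous; apply/derivable1_diffP; exact: ex_derive.
have cE t : {for t, continuous (fun s : R => expR (- s))}.
  by apply: continuous_comp; [exact: continuousN|exact: continuous_expR].
have := @integration_by_parts R (fun t => t `^ x) (fun t => - expR (- t))
  (fun t => x * t `^ (x - 1)) (fun t => expR (- t)) a b ab.
rewrite /exhausting_itv -/a -/b.
have -> : gamma_integrand (x + 1) = fun t => t `^ x * expR (- t).
  by apply/funext => t; rewrite /gamma_integrand addrK.
move=> ->; last first.
- by move=> t _; rewrite derive1E; apply: derive_val.
- split; first by move=> t _; exact: ex_derive.
    exact/cvg_at_right_filter/cG.
  exact/cvg_at_left_filter/cG.
- by apply: continuous_subspaceT => t; exact: cE.
- move=> t; rewrite in_itv /= => /andP[at_ _]; rewrite derive1E.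
  by apply: (@derive_val _ _ _ _ _ _ _ (dF t _)); exact: lt_trans at_.
- split.
  + move=> t; rewrite in_itv /= => /andP[at_ _].
    by apply: (@ex_derive _ _ _ _ _ _ _ (dF t _)); exact: lt_trans at_.
  + exact/cvg_at_right_filter/cpow.
  + by apply/cvg_at_left_filter/cpow; exact: lt_trans ab.
- apply: continuous_in_subspaceT => t.
  rewrite inE /= in_itv /= => /andP[at_ _].
  by apply: cvgM; [exact: cvg_cst|apply: cpow; exact: lt_le_trans at_].
congr (_ + _)%E; first by congr EFin; ring.
rewrite -ge0_integralZl //=; last exact: ltW.
- rewrite -integralN /=.
  + by apply: eq_integral => t _; rewrite -EFinM /gamma_integrand; congr EFin; ring.
  + apply: integrable_add_def => /=; first exact: measurable_itv.
    apply: continuous_compact_integrable; first exact: segment_compact.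
    apply: continuous_in_subspaceT => t.
    rewrite inE /= in_itv /= => /andP[at_ _].
    apply: cvgM; last exact: cG.
    by apply: cvgM; [exact: cvg_cst|apply: cpow; exact: lt_le_trans at_].
- exact: measurable_gamma_integrand.
- by move=> t _; rewrite lee_fin gamma_integrand_ge0.
Qed.

(** The functional equation comes from integrating t^x e^(-t) by parts on the
    exhausting intervals: the boundary terms tend to 0 and both integrals
    converge monotonically. *)
Lemma gamma_eintegralD1 x : 0 < x ->
  gamma_eintegral (x + 1) = (x%:E * gamma_eintegral x)%E.
Proof.
move=> x0; have := gamma_eintegral_cvg (x + 1).
have -> : (fun n => \int[mu]_(t in exhausting_itv n)
    (gamma_integrand (x + 1) t)%:E)%E = fun n =>
  ((n.+1%:R^-1 `^ x * expR (- n.+1%:R^-1) - n.+2%:R `^ x * expR (- n.+2%:R))%:E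
   + x%:E * \int[mu]_(t in exhausting_itv n) (gamma_integrand x t)%:E)%E.
  by apply/funext => n; exact: gamma_by_parts.
move=> /cvg_unique; apply => //.
rewrite -[(x%:E * _)%E]add0e; apply: cvgeD => //.
  apply/cvg_EFin; first exact: nearW.
  rewrite -[X in _ --> X](subrr 0); apply: cvgB.
    exact: powR_expRN_inv_cvg0.
  exact: powR_expRN_cvg0.
by apply: cvgeZl => //; exact: gamma_eintegral_cvg.
Qed.

Lemma gamma_eintegral1 : gamma_eintegral 1 = 1%E.
Proof.
rewrite /gamma_eintegral.
under eq_integral do rewrite /gamma_integrand subrr powRr0 mul1r.
have dG t : is_derive t 1 (fun s : R => - expR (- s)) (expR (- t)).
  by apply: is_derive_eq; rewrite mulrN1 opprK.
have cE t : {for t, continuous (fun s : R => expR (- s))}.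
  by apply: continuous_comp; [exact: continuousN|exact: continuous_expR].
rewrite integral_itv_obnd_cbnd; last first.
  apply: measurableT_comp => //.
  by apply: measurableT_comp; [exact: measurable_expR|exact: oppr_measurable].
rewrite (@ge0_continuous_FTC2y _ _ (fun t : R => - expR (- t)) 0 0).
- by rewrite oppr0 expR0 sub0e EFinN oppeK.
- by move=> t _; exact: expR_ge0.
- by apply: continuous_subspaceT => t; exact: cE.
- by rewrite -oppr0; apply: cvgN; exact: cvgr_expR.
- by move=> t _; exact: ex_derive.
- by apply/cvg_at_right_filter; apply: cvgN; exact: cE.
- by move=> t _; rewrite derive1E; apply: derive_val.
Qed.

Lemma gamma_eintegral_nat (n : nat) : gamma_eintegral n.+1%:R \is a fin_num.
Proof.
elim: n => [|n IH]; first by rewrite gamma_eintegral1.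
by rewrite -natr1 gamma_eintegralD1 ?ltr0n // fin_numM.
Qed.

Lemma gamma_eintegral_ge0 x : (0 <= gamma_eintegral x)%E.
Proof. by apply: integral_ge0 => t _; rewrite lee_fin gamma_integrand_ge0. Qed.

(** For y >= 1 the integrand is at most the sum of those of 1 and of an integer
    above y, whose integrals are finite by the functional equation; arguments in
    ]0, 1[ are reached by one more application of that equation. *)
Lemma gamma_eintegral_fin x : 0 < x -> gamma_eintegral x \is a fin_num.
Proof.
have large y : 1 <= y -> gamma_eintegral y \is a fin_num.
  move=> y1; rewrite ge0_fin_numE ?gamma_eintegral_ge0 //.
  set n := (Num.truncn y).
  have le_pow t : 0 < t ->
      gamma_integrand y t <= gamma_integrand 1 t + gamma_integrand n.+1%:R t.
    move=> t0; rewrite -mulrDl ler_wpM2r ?expR_ge0 // subrr powRr0.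
    have [t1|/ltW t1] := leP t 1.
      apply: (@le_trans _ _ 1); last by rewrite lerDl powR_ge0.
      by rewrite -[leRHS](powRr0 t); apply: ger_powR; rewrite ?t0 ?subr_ge0.
    apply: (@le_trans _ _ (t `^ (n.+1%:R - 1))); last by rewrite lerDr.
    by apply: ler_powR => //; rewrite lerB // ltW // truncnS_gt.
  apply: (@le_lt_trans _ _ (gamma_eintegral 1 + gamma_eintegral n.+1%:R)%E).
    rewrite -ge0_integralD //; first last.
    - exact: measurable_gamma_integrand.
    - by move=> t _; rewrite lee_fin gamma_integrand_ge0.
    - exact: measurable_gamma_integrand.
    - by move=> t _; rewrite lee_fin gamma_integrand_ge0.
    apply: ge0_le_integral => //.
    - by move=> t _; rewrite lee_fin gamma_integrand_ge0.
    - exact: measurable_gamma_integrand.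
    - by apply: emeasurable_funD; exact: measurable_gamma_integrand.
    - by move=> t /=; rewrite in_itv /= andbT => t0; rewrite -EFinD lee_fin le_pow.
  rewrite lte_add_pinfty // -?ge0_fin_numE ?gamma_eintegral_ge0 //.
    exact: (gamma_eintegral_nat 0).
  exact: gamma_eintegral_nat.
move=> x0.
have : gamma_eintegral (x + 1) \is a fin_num by apply: large; rewrite lerDr ltW.
rewrite gamma_eintegralD1 // !ge0_fin_numE ?mule_ge0 ?gamma_eintegral_ge0 ?lee_fin ?(ltW x0) //.
have := gamma_eintegral_ge0 x.
by case: (gamma_eintegral x) => [r|//|//] _; rewrite ?ltry // gt0_muley.
Qed.

(** For y >= 1 the integrand is at least e^(-2) on [1, 2]; the functional equation
    extends positivity to ]0, 1[. *)
Lemma gamma_eintegral_gt0 x : 0 < x -> (0 < gamma_eintegral x)%E.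
Proof.
have large y : 1 <= y -> (0 < gamma_eintegral y)%E.
  move=> y1; apply: (@lt_le_trans _ _
    (\int[mu]_(t in `[1%R, 2%R]) (expR (- 2))%:E)%E).
    rewrite integral_cst //= lebesgue_measure_itv /= lte_fin ltr1n /=.
    by rewrite -EFinB -EFinM lte_fin mulr_gt0 ?expR_gt0 // subr_gt0 ltr1n.
  apply: (@le_trans _ _
    (\int[mu]_(t in `[1%R, 2%R]) (gamma_integrand y t)%:E)%E).
    apply: ge0_le_integral => //.
    - exact: measurable_gamma_integrand.
    - move=> t /=; rewrite in_itv /= => /andP[t1 t2]; rewrite lee_fin.
      rewrite -[leLHS]mul1r ler_pM ?expR_ge0 //; last by rewrite ler_expR lerN2.
      by rewrite -[leLHS](powRr0 t); apply: ler_powR => //; rewrite subr_ge0.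
  apply: ge0_subset_integral => //.
  - exact: measurable_gamma_integrand.
  - by move=> t _; rewrite lee_fin gamma_integrand_ge0.
  - by move=> t /=; rewrite !in_itv /= andbT => /andP[t1 _]; exact: lt_le_trans t1.
move=> x0.
have : (0 < gamma_eintegral (x + 1))%E by apply: large; rewrite lerDr ltW.
by rewrite gamma_eintegralD1 // pmule_rgt0.
Qed.

Lemma Gamma_eintegral x : 0 < x -> Gamma x = fine (gamma_eintegral x).
Proof. by move=> x0; rewrite /Gamma x0. Qed.

Lemma Gamma_gt0 x : 0 < x -> 0 < Gamma x.
Proof.
move=> x0; rewrite Gamma_eintegral // fine_gt0 // gamma_eintegral_gt0 //=.
by rewrite -ge0_fin_numE ?gamma_eintegral_ge0 // gamma_eintegral_fin.
Qed.

Lemma GammaD1 x : 0 < x -> Gamma (x + 1) = x * Gamma x.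
Proof.
move=> x0; rewrite !Gamma_eintegral ?addr_gt0 // gamma_eintegralD1 //.
by rewrite fineM // gamma_eintegral_fin.
Qed.

Lemma Gamma1 : Gamma 1 = 1 :> R.
Proof. by rewrite Gamma_eintegral // gamma_eintegral1. Qed.

Lemma Gamma_nat (n : nat) : Gamma n.+1%:R = n`!%:R :> R.
Proof.
elim: n => [|n IH]; first by rewrite Gamma1.
by rewrite -natr1 GammaD1 ?ltr0n // IH factS natrM.
Qed.

Lemma Gamma_rising x (n : nat) : 0 < x ->
  Gamma (x + n%:R) = (\prod_(i < n) (x + i%:R)) * Gamma x.
Proof.
move=> x0; elim: n => [|n IH]; first by rewrite big_ord0 mul1r addr0.
rewrite -natr1 addrA GammaD1; last by rewrite ltr_wpDr.
by rewrite IH big_ord_recr /= mulrA [_ * (x + _)]mulrC.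
Qed.

End gamma_function.

(** * Second-order expansions *)

Section taylor.
Context {R : realType}.
Implicit Types (g : R -> R) (x e : R).

(** Restricting to the segment from x to x + e, parametrised by [0, 1], lets the
    next two lemmas treat both signs of e, and e = 0, at once. *)
Lemma is_derive_affine_comp g (dg x e s : R) :
  is_derive (x + s * e) 1 g dg ->
  is_derive s 1 (fun r => g (x + r * e)) (dg * e).
Proof.
move=> gd; have ad : is_derive s 1 (fun r => x + r * e) e.
  by apply: is_derive_eq; rewrite /GRing.scale /=; ring.
exact: is_derive1_comp.
Qed.

Lemma is_derive_continuous g (dg : R -> R) :
  (forall x : R, is_derive x 1 g (dg x)) -> continuous g.
Proof.
move=> gd x; apply: differentiable_continuous; apply/derivable1_diffP.
exact: ex_derive.
Qed.

Lemma norm_segment_le (c x e : R) : 0 < c < 1 -> `|x + c * e - x| <= `|e|.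
Proof.
move=> /andP[c0 c1]; rewrite addrC addKr normrM gtr0_norm //.
by rewrite ler_piMl // ltW.
Qed.

Lemma mean_value g (dg : R -> R) x e :
  (forall z : R, is_derive z 1 g (dg z)) ->
  exists2 c, `|c - x| <= `|e| & g (x + e) = g x + dg c * e.
Proof.
move=> gd; pose G s := g (x + s * e).
have Gd (s : R) : is_derive s 1 G (dg (x + s * e) * e).
  by apply: is_derive_affine_comp.
have [|c] := @MVT R G (fun s => dg (x + s * e) * e) 0 1 ltr01 (fun s _ => Gd s).
  exact/continuous_subspaceT/(is_derive_continuous _ _ Gd).
rewrite in_itv /= => c01; rewrite /G mul1r mul0r addr0 subr0 mulr1 => Gc.
exists (x + c * e); first exact: norm_segment_le.
by rewrite -Gc; ring.
Qed.

(** Rolle's theorem for the auxiliary function H, which takes the value g (x + e)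
    at both ends of [0, 1] by the choice of K. *)
Lemma taylor_lagrange2 g (dg ddg : R -> R) x e :
  (forall z : R, is_derive z 1 g (dg z)) -> (forall z : R, is_derive z 1 dg (ddg z)) ->
  exists2 c, `|c - x| <= `|e| &
    g (x + e) = g x + dg x * e + ddg c * e ^+ 2 / 2.
Proof.
move=> gd dgd; set K := g (x + e) - g x - dg x * e.
pose H s := g (x + s * e) + (1 - s) * e * dg (x + s * e) + (1 - s) ^+ 2 * K.
have Hd (s : R) : is_derive s 1 H
    ((1 - s) * (ddg (x + s * e) * e ^+ 2 - 2 * K)).
  have Gd : is_derive s 1 (fun r => g (x + r * e)) (dg (x + s * e) * e).
    by apply: is_derive_affine_comp.
  have dGd : is_derive s 1 (fun r => dg (x + r * e)) (ddg (x + s * e) * e).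
    by apply: is_derive_affine_comp.
  by apply: is_derive_eq; rewrite /GRing.scale /=; ring.
have [||c] := @Rolle R H 0 1 ltr01 (fun s _ => @ex_derive _ _ _ _ _ _ _ (Hd s)).
- exact/continuous_subspaceT/(is_derive_continuous _ _ Hd).
- by rewrite /H mul0r mul1r addr0 /K; ring.
rewrite in_itv /= => c01 Hc.
have : (1 - c) * (ddg (x + c * e) * e ^+ 2 - 2 * K) = 0.
  by rewrite -(@derive_val _ _ _ _ _ _ _ (Hd c)); exact: derive_val.
move/eqP; rewrite mulf_eq0 subr_eq0 => /orP[/eqP c1|/eqP cK].
  by move: c01; rewrite -c1 ltxx andbF.
exists (x + c * e); first exact: norm_segment_le.
have -> : ddg (x + c * e) * e ^+ 2 = 2 * K by apply/eqP; rewrite -subr_eq0 cK.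
by rewrite /K; field.
Qed.

End taylor.

Section second_order.
Context {R : realType}.
Implicit Types F : R -> R -> R -> R.

Lemma derivable_is_derive1 (g : R -> R) (x : R) :
  derivable g x 1 -> is_derive x 1 g (g^`()%classic x).
Proof. by move=> gd; rewrite derive1E; exact: derivableP. Qed.

Definition quadratic_form F (u v w a b c : R) : R :=
  pu (pu F) u v w * a ^+ 2 + 2 * (pv (pu F) u v w * (a * b))
  + 2 * (pw (pu F) u v w * (a * c)) + pv (pv F) u v w * b ^+ 2
  + 2 * (pw (pv F) u v w * (b * c)) + pw (pw F) u v w * c ^+ 2.

(** The increment is split by moving the third variable first, then the second,
    then the first: Taylor expansions of order 2 along each axis, and the mean
    value theorem for the first derivatives.  In this order only the mixed
    derivatives (F_u)_v, (F_u)_w and (F_v)_w occur, so neither their symmetry nor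
    the existence of the others is involved. *)
Lemma second_order_lagrange F (u v w a b c : R) : second_order_C F ->
  exists P : nat -> R * R * R,
    (forall i, [/\ `|(P i).1.1 - u| <= `|a|, `|(P i).1.2 - v| <= `|b|
                 & `|(P i).2 - w| <= `|c|]) /\
    F (u + a) (v + b) (w + c) = F u v w
      + (pu F u v w * a + pv F u v w * b + pw F u v w * c)
      + (pu (pu F) (P 0%N).1.1 (P 0%N).1.2 (P 0%N).2 * a ^+ 2
         + 2 * (pv (pu F) (P 1%N).1.1 (P 1%N).1.2 (P 1%N).2 * (a * b))
         + 2 * (pw (pu F) (P 2%N).1.1 (P 2%N).1.2 (P 2%N).2 * (a * c))
         + pv (pv F) (P 3%N).1.1 (P 3%N).1.2 (P 3%N).2 * b ^+ 2
         + 2 * (pw (pv F) (P 4%N).1.1 (P 4%N).1.2 (P 4%N).2 * (b * c))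
         + pw (pw F) (P 5%N).1.1 (P 5%N).1.2 (P 5%N).2 * c ^+ 2) / 2.
Proof.
move=> [[Fu Fv Fw] [[Fuu Fuv Fuw] [[Fvv Fvw Fww] _]]].
have [c0 c0u E0] := @taylor_lagrange2 R (fun x => F x (v + b) (w + c))
  (fun x => pu F x (v + b) (w + c)) (fun x => pu (pu F) x (v + b) (w + c)) u a
  (fun z => derivable_is_derive1 _ _ (Fu z _ _))
  (fun z => derivable_is_derive1 _ _ (Fuu z _ _)).
have [c1 c1v E1] := @mean_value R (fun x => pu F u x (w + c))
  (fun x => pv (pu F) u x (w + c)) v b
  (fun z => derivable_is_derive1 _ _ (Fuv _ z _)).
have [c2 c2w E2] := @mean_value R (fun x => pu F u v x)
  (fun x => pw (pu F) u v x) w c (fun z => derivable_is_derive1 _ _ (Fuw _ _ z)).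
have [c3 c3v E3] := @taylor_lagrange2 R (fun x => F u x (w + c))
  (fun x => pv F u x (w + c)) (fun x => pv (pv F) u x (w + c)) v b
  (fun z => derivable_is_derive1 _ _ (Fv _ z _))
  (fun z => derivable_is_derive1 _ _ (Fvv _ z _)).
have [c4 c4w E4] := @mean_value R (fun x => pv F u v x)
  (fun x => pw (pv F) u v x) w c (fun z => derivable_is_derive1 _ _ (Fvw _ _ z)).
have [c5 c5w E5] := @taylor_lagrange2 R (fun x => F u v x)
  (fun x => pw F u v x) (fun x => pw (pw F) u v x) w c
  (fun z => derivable_is_derive1 _ _ (Fw _ _ z))
  (fun z => derivable_is_derive1 _ _ (Fww _ _ z)).
(* The points come from a list; its default value lies in the box as well, so
   that the bounds hold for every index. *)
exists (nth (u, v, w) [:: (c0, v + b, w + c); (u, c1, w + c); (u, v, c2);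
                          (u, c3, w + c); (u, v, c4); (u, v, c5)]).
split.
  have e0 (z y : R) : `|z - z| <= `|y| by rewrite subrr normr0.
  have e1 (z y : R) : `|z + y - z| <= `|y| by rewrite addrC addKr.
  by move=> [|[|[|[|[|[|i]]]]]] /=; split=> //; rewrite ?nth_nil.
rewrite /= E0 E1 E2 E3 E4 E5.
move: (pu (pu F) c0 _ _) (pv (pu F) u c1 _) (pw (pu F) u v c2).
move: (pv (pv F) u c3 _) (pw (pv F) u v c4) (pw (pw F) u v c5).
move: (pu F u v w) (pv F u v w) (pw F u v w) (F u v w) => *.
by field.
Qed.

Lemma cvg_at_lipschitz (f : R -> R) (x a : R) :
  (forall e, `|f e - x| <= `|e * a|) -> f e @[e --> 0] --> x.
Proof.
move=> fx; apply/cvgrPdist_le => eps eps0.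
have a1 : 0 < `|a| + 1 by rewrite ltr_wpDl.
apply: (@filterS _ _ _ _ _ _ (@nbhs0_le R R _ (divr_gt0 eps0 a1))) => e.
rewrite ler_pdivlMr // => ea; rewrite distrC (le_trans (fx e)) // normrM.
by rewrite (le_trans _ ea) // ler_wpM2l // lerDl.
Qed.

(** The six intermediate points stay in a box of size O(e), so continuity of the
    second derivatives gives the limit of the remainder. *)
Lemma second_order_expansion F (u v w a b c : R) : second_order_C F ->
  exists2 q : R -> R, q e @[e --> 0] --> quadratic_form F u v w a b c &
    forall e, F (u + e * a) (v + e * b) (w + e * c) = F u v w
      + e * (pu F u v w * a + pv F u v w * b + pw F u v w * c)
      + e ^+ 2 / 2 * q e.
Proof.
move=> FC; have [P PE] := choice (fun e =>
  @second_order_lagrange F u v w (e * a) (e * b) (e * c) FC).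
pose d2 (G : R -> R -> R -> R) i e := G (P e i).1.1 (P e i).1.2 (P e i).2.
exists (fun e => d2 (pu (pu F)) 0%N e * a ^+ 2
  + 2 * (d2 (pv (pu F)) 1%N e * (a * b))
  + 2 * (d2 (pw (pu F)) 2%N e * (a * c)) + d2 (pv (pv F)) 3%N e * b ^+ 2
  + 2 * (d2 (pw (pv F)) 4%N e * (b * c)) + d2 (pw (pw F)) 5%N e * c ^+ 2).
  have d2_cvg G i : continuous3 G -> d2 G i e @[e --> 0] --> G u v w.
    move=> /(_ (u, v, w)) Gc.
    apply: (@cvg_comp _ _ _ (fun e => ((P e i).1.1, (P e i).1.2, (P e i).2))
      (fun p : R * R * R => G p.1.1 p.1.2 p.2) _ (nbhs (u, v, w))); last exact: Gc.
    have Pu : (P e i).1.1 @[e --> 0] --> u.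
      by apply: (cvg_at_lipschitz _ _ a) => e; have [/(_ i)[]] := PE e.
    have Pv : (P e i).1.2 @[e --> 0] --> v.
      by apply: (cvg_at_lipschitz _ _ b) => e; have [/(_ i)[]] := PE e.
    have Pw : (P e i).2 @[e --> 0] --> w.
      by apply: (cvg_at_lipschitz _ _ c) => e; have [/(_ i)[]] := PE e.
    exact: (cvg_pair (cvg_pair Pu Pv) Pw).
  have [_ [_ [_ [[? ? ?] [? ? ?]]]]] := FC.
  have term_cvg G i k : continuous3 G ->
      d2 G i e * k @[e --> 0] --> G u v w * k.
    by move=> Gc; apply: cvgM; [exact: d2_cvg|exact: cvg_cst].
  have dbl_cvg G i k : continuous3 G ->
      2 * (d2 G i e * k) @[e --> 0] --> 2 * (G u v w * k).
    by move=> Gc; apply: cvgM; [exact: cvg_cst|exact: term_cvg].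
  rewrite /quadratic_form.
  apply: cvgD; last exact: term_cvg.
  apply: cvgD; last exact: dbl_cvg.
  apply: cvgD; last exact: term_cvg.
  apply: cvgD; last exact: dbl_cvg.
  by apply: cvgD; [exact: term_cvg|exact: dbl_cvg].
move=> e; have [_ ->] := PE e; rewrite /d2.
move: (pu (pu F) _ _ _) (pv (pu F) _ _ _) (pw (pu F) _ _ _).
move: (pv (pv F) _ _ _) (pw (pv F) _ _ _) (pw (pw F) _ _ _).
move: (pu F u v w) (pv F u v w) (pw F u v w) (F u v w) => *.
by field.
Qed.

(** Adding the expansions at e and -e cancels the linear term. *)
Lemma expansion_at_min_ge0 (phi q : R -> R) (l Q : R) :
  q e @[e --> 0] --> Q ->
  (forall e, phi e = phi 0 + e * l + e ^+ 2 / 2 * q e) ->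
  (\forall e \near 0, phi 0 <= phi e) -> 0 <= Q.
Proof.
move=> qQ phiE phi_min; rewrite leNgt; apply/negP => Q0.
have qN : \forall e \near (0 : R), q e < 0 by exact: (cvgr_lt _ qQ).
have [r /= r0 rP] : \forall e \near (0 : R), q e < 0 /\ phi 0 <= phi e.
  by near=> e; split; near: e.
have r2 : 0 < r / 2 by rewrite divr_gt0.
have r2r : r / 2 < r by rewrite ltr_pdivrMr // ltr_pMr // ltr1n.
have [|qp phip] := rP (r / 2); first by rewrite /= sub0r normrN gtr0_norm.
have [|qm phim] := rP (- (r / 2)); first by rewrite /= sub0r opprK gtr0_norm.
move: phip phim; rewrite (phiE (r / 2)) (phiE (- _)) sqrrN mulNr => phip phim.
have s0 : 0 < (r / 2) ^+ 2 / 2 by rewrite divr_gt0 // exprn_gt0.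
have : (r / 2) ^+ 2 / 2 * (q (r / 2) + q (- (r / 2))) < 0.
  by rewrite pmulr_rlt0 //; lra.
rewrite mulrDr; lra.
Unshelve. all: by end_near. Qed.

End second_order.

(** * Sums over intervals of hZ *)

Section sums.
Context {R : realType}.
Implicit Types (h r x y e : R) (f g : R -> R) (k m p s : int).

Lemma finite_int_itv x y : finite_set [set k : int | x <= k%:~R <= y].
Proof.
pose N := maxn `|Num.floor x|%N `|Num.ceil y|%N.
apply: (@sub_finite_set _ _ ((fun i : nat => i%:Z - N%:Z) @` `I_(N + N).+1)).
  move=> k /= /andP[/le_floor + /le_ceil]; rewrite intrKfloor intrKceil => xk ky.
  exists (absz (k + N%:Z)); lia.
exact/finite_image/finite_II.
Qed.

Lemma sum_only_at (k0 : int) (P : set int) (G : int -> R) :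
  (forall k, k != k0 -> G k = 0) ->
  \sum_(k \in P) G k = if k0 \in P then G k0 else 0.
Proof.
move=> G0; case: ifPn => [/set_mem Pk|/negP Pk].
  rewrite -(@fsbig_widen _ _ _ _ [set k0] P G) ?fsbig_set1 //; first by move=> k ->.
  by move=> k [_ /eqP]; exact: G0.
apply: fsbig1 => k Pk'; apply: G0; apply: contra_notN Pk => /eqP <-.
exact: mem_set.
Qed.

Lemma hint_nat h p (n : nat) f : 0 < h ->
  hint h (p%:~R * h) ((p + n%:Z)%:~R * h) f =
  \sum_(i < n) f ((p + i%:Z)%:~R * h) * h.
Proof.
move=> h0; have hN0 : h != 0 by rewrite gt_eqF.
rewrite /hint !mulfK // -(big_mkord xpredT (fun i => f ((p + i%:Z)%:~R * h) * h)).
rewrite -(big_map (fun i : nat => p + i%:Z) xpredT (fun k => f (k%:~R * h) * h)).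
rewrite [RHS]fsbig_seq; last first.
  by rewrite map_inj_uniq ?iota_uniq // => i j /addrI [].
apply: eq_fsbigl; apply/seteqP; split => k /=; rewrite -(intrB _ _ 1) !ler_int.
  move=> /andP[pk kn]; apply/mapP; exists (absz (k - p)); last by lia.
  by rewrite mem_index_iota; lia.
by move=> /mapP[i]; rewrite mem_index_iota => /= ni ->; lia.
Qed.

Lemma eq_hint h (p q : int) f g (c : R) : 0 < h ->
  (forall s : int, p <= s < q -> f (s%:~R * h) = c * g (s%:~R * h)) ->
  hint h (p%:~R * h) (q%:~R * h) f = c * hint h (p%:~R * h) (q%:~R * h) g.
Proof.
move=> h0 fg; have hN0 : h != 0 by rewrite gt_eqF.
rewrite /hint !mulfK // mulr_fsumr; apply: eq_fsbigr => s /set_mem /=.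
rewrite -(intrB _ _ 1) !ler_int => ps.
by rewrite mulrA fg //; lia.
Qed.

Lemma hint_cat h (p q s : int) f : 0 < h -> p <= q -> q <= s ->
  hint h (p%:~R * h) (s%:~R * h) f =
  hint h (p%:~R * h) (q%:~R * h) f + hint h (q%:~R * h) (s%:~R * h) f.
Proof.
move=> h0 pq qs.
have qE : q = p + (absz (q - p)%R)%:Z by lia.
have sE : s = p + (absz (q - p)%R + absz (s - q)%R)%N%:Z by lia.
rewrite {1}sE hint_nat // big_split_ord /=; congr (_ + _).
  by rewrite -hint_nat // -qE.
rewrite [in RHS](_ : s = q + (absz (s - q)%R)%:Z) ?hint_nat //; last by lia.
apply: eq_bigr => i _; congr (f (_%:~R * h) * h).
by rewrite PoszD addrA -qE.
Qed.

Lemma hint1 h (s : int) f : 0 < h ->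
  hint h (s%:~R * h) ((s + 1)%:~R * h) f = f (s%:~R * h) * h.
Proof. by move=> h0; rewrite (hint_nat _ _ 1) // big_ord1 addr0. Qed.

End sums.

(** * Linearity of fractional sums and differences *)

Section linearity.
Context {R : realType}.
Implicit Types (h a b r x e : R) (f g : R -> R).

Lemma left_hsumD h a r f g x :
  left_hsum h a r (fun z => f z + g z) x =
  left_hsum h a r f x + left_hsum h a r g x.
Proof.
rewrite /left_hsum; case: ifP => // _; rewrite -mulrDr; congr (_ * _).
rewrite -fsbig_split; last exact: finite_int_itv.
by apply: eq_fsbigr => k _; rewrite /=; ring.
Qed.

Lemma left_hsumZ h a r e f x :
  left_hsum h a r (fun z => e * f z) x = e * left_hsum h a r f x.
Proof.
rewrite /left_hsum; case: ifP => // _; rewrite mulrCA; congr (_ * _).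
by rewrite mulr_fsumr; apply: eq_fsbigr => k _; ring.
Qed.

Lemma right_hsumD h b r f g x :
  right_hsum h b r (fun z => f z + g z) x =
  right_hsum h b r f x + right_hsum h b r g x.
Proof.
rewrite /right_hsum; case: ifP => // _; rewrite -mulrDr; congr (_ * _).
rewrite -fsbig_split; last exact: finite_int_itv.
by apply: eq_fsbigr => k _; rewrite /=; ring.
Qed.

Lemma right_hsumZ h b r e f x :
  right_hsum h b r (fun z => e * f z) x = e * right_hsum h b r f x.
Proof.
rewrite /right_hsum; case: ifP => // _; rewrite mulrCA; congr (_ * _).
by rewrite mulr_fsumr; apply: eq_fsbigr => k _; ring.
Qed.

Lemma left_hdiffD h a r f g x :
  left_hdiff h a r (fun z => f z + g z) x =
  left_hdiff h a r f x + left_hdiff h a r g x.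
Proof. by rewrite /left_hdiff /hdelta !left_hsumD; ring. Qed.

Lemma left_hdiffZ h a r e f x :
  left_hdiff h a r (fun z => e * f z) x = e * left_hdiff h a r f x.
Proof. by rewrite /left_hdiff /hdelta !left_hsumZ; ring. Qed.

Lemma right_hdiffD h b r f g x :
  right_hdiff h b r (fun z => f z + g z) x =
  right_hdiff h b r f x + right_hdiff h b r g x.
Proof. by rewrite /right_hdiff /hdelta !right_hsumD; ring. Qed.

Lemma right_hdiffZ h b r e f x :
  right_hdiff h b r (fun z => e * f z) x = e * right_hdiff h b r f x.
Proof. by rewrite /right_hdiff /hdelta !right_hsumZ; ring. Qed.

End linearity.

(** * Fractional differences of a spike *)

Section spike.
Context {R : realType}.
Implicit Types (h r x : R) (k m p s : int).

(** The coefficient of z^n in (1 - z)^(-r). *)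
Definition hsum_coef r (n : nat) : R := (\prod_(i < n) (r + i%:R)) / n`!%:R.

Lemma hsum_coef0 r : hsum_coef r 0 = 1.
Proof. by rewrite /hsum_coef big_ord0 fact0 divr1. Qed.

Lemma hsum_coef1 r : hsum_coef r 1 = r.
Proof. by rewrite /hsum_coef big_ord1 addr0 divr1. Qed.

Lemma hsum_coef_r0 (n : nat) : hsum_coef 0 n.+1 = 0.
Proof. by rewrite /hsum_coef big_ord_recl /= addr0 !mul0r. Qed.

(** Both gamma values of the factorial function are reduced by the functional
    equation, to Gamma r and to a factorial. *)
Lemma hfact_hsum_coef h r (n : nat) : 0 < h -> 0 < r ->
  (Gamma r)^-1 * hfact h ((n%:R + r - 1) * h) (r - 1) =
  h `^ (r - 1) * hsum_coef r n.
Proof.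
move=> h0 r0; rewrite /hfact mulfK ?gt_eqF //.
have -> : n%:R + r - 1 + 1 = r + n%:R by ring.
have -> : r + n%:R - (r - 1) = n.+1%:R by rewrite -natr1; ring.
rewrite Gamma_rising // Gamma_nat /hsum_coef.
have := Gamma_gt0 _ r0; set G := Gamma r => G0.
have := fact_gt0 n; rewrite -(ltr0n R) => f0.
by field; rewrite !gt_eqF.
Qed.

(** The difference of consecutive coefficients of (1 - z)^(-r) is a coefficient of
    (1 - z)^(1 - r); its first two factors r - 1 and r are split off, and the rest
    is Gamma (r + 1 + j) / Gamma (r + 1). *)
Lemma hfact_hsum_coefB h r (j : nat) : 0 < h -> 0 <= r ->
  r * (r - 1) / Gamma (r + 1) * hfact h ((j%:R + r) * h) (r - 2) =
  h `^ (r - 2) * (hsum_coef r j.+2 - hsum_coef r j.+1).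
Proof.
move=> h0 r0; rewrite /hfact mulfK ?gt_eqF //.
have r1 : 0 < r + 1 by rewrite ltr_wpDl.
have -> : j%:R + r + 1 = r + 1 + j%:R by ring.
have -> : r + 1 + j%:R - (r - 2) = j.+3%:R by rewrite -!natr1; ring.
rewrite Gamma_rising // Gamma_nat /hsum_coef.
have := Gamma_gt0 _ r1; set G := Gamma _ => G0.
have shift n : \prod_(i < n.+1) (r + i%:R) = r * \prod_(i < n) (r + 1 + i%:R).
  rewrite big_ord_recl /= addr0; congr (_ * _); apply: eq_bigr => i _.
  by rewrite /bump /= add1n -natr1; ring.
rewrite !shift big_ord_recr /= (factS j.+1) natrM.
have := fact_gt0 j.+1; rewrite -(ltr0n R) => f0.
have j0 := ler0n R j.
rewrite -!natr1; field.
by rewrite !gt_eqF //; lra.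
Qed.

(** The value h, rather than 1, cancels the division by h in the differences,
    which become h^r times numbers depending on r only. *)
Definition spike h m x : R := if x == m%:~R * h then h else 0.

Lemma spikeE h m s : 0 < h -> spike h m (s%:~R * h) = if s == m then h else 0.
Proof.
by move=> h0; rewrite /spike (inj_eq (mulIf (lt0r_neq0 h0))) eqr_int.
Qed.

(** Only the summand at m survives.  The formula covers r = 0 as well, the
    coefficients of (1 - z)^0 being 1, 0, 0, and so on. *)
Lemma left_hsum_spike h r p m s : 0 < h -> 0 <= r -> p <= m ->
  left_hsum h (p%:~R * h) r (spike h m) (s%:~R * h) =
  if m <= s then h `^ (r + 1) * hsum_coef r (absz (s - m)) else 0.
Proof.
move=> h0 r0 pm; have hN0 : h != 0 by rewrite gt_eqF.
rewrite /left_hsum; case: eqVneq => [->|rN0].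
  (* Order 0, where the sum is defined to be the function itself. *)
  rewrite spikeE // add0r powRr1 ?(ltW h0) //; case: (eqVneq s m) => [->|sm].
    by rewrite lexx subrr hsum_coef0 mulr1.
  case: ifP => // ms; have -> : absz (s - m) = (absz (s - m)).-1.+1 by lia.
  by rewrite hsum_coef_r0 mulr0.
have {}r0 : 0 < r by rewrite lt_def rN0.
rewrite !mulfK // (sum_only_at m); last first.
  by move=> k km; rewrite spikeE // (negbTE km) mulr0 mul0r.
have -> : (m \in [set k : int | (p%:~R : R) <= (k%:~R : R) <= (s%:~R : R)]) = (m <= s).
  apply/idP/idP => [/set_mem /= /andP[_]|ms]; first by rewrite ler_int.
  by apply: mem_set => /=; rewrite !ler_int pm.
case: ifP => [ms|_]; last by rewrite mulr0.
rewrite spikeE // eqxx /sigma.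
have -> : s%:~R * h + r * h - (m%:~R * h + h) =
    ((absz (s - m))%:R + r - 1) * h.
  rewrite -[(absz _)%:R]/((absz (s - m))%:Z%:~R) gez0_abs ?subr_ge0 // intrB; ring.
rewrite mulrA mulrA hfact_hsum_coef // (_ : r + 1 = r - 1 + 1 + 1); last by ring.
rewrite !(@powRD _ h _ 1) ?hN0 ?implybT // !powRr1 ?(ltW h0) //; ring.
Qed.

Lemma right_hsum_spike h r (q m s : int) : 0 < h -> 0 <= r -> m <= q ->
  right_hsum h (q%:~R * h) r (spike h m) (s%:~R * h) =
  if s <= m then h `^ (r + 1) * hsum_coef r (absz (m - s)) else 0.
Proof.
move=> h0 r0 mq; have hN0 : h != 0 by rewrite gt_eqF.
rewrite /right_hsum; case: eqVneq => [->|rN0].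
  rewrite spikeE // add0r powRr1 ?(ltW h0) //; case: (eqVneq s m) => [->|sm].
    by rewrite lexx subrr hsum_coef0 mulr1.
  case: ifP => // ms; have -> : absz (m - s) = (absz (m - s)).-1.+1 by lia.
  by rewrite hsum_coef_r0 mulr0.
have {}r0 : 0 < r by rewrite lt_def rN0.
rewrite !mulfK // (sum_only_at m); last first.
  by move=> k km; rewrite spikeE // (negbTE km) mulr0 mul0r.
have -> : (m \in [set k : int | (s%:~R : R) <= (k%:~R : R) <= (q%:~R : R)]) = (s <= m).
  apply/idP/idP => [/set_mem /= /andP[+ _]|ms]; first by rewrite ler_int.
  by apply: mem_set => /=; rewrite !ler_int mq andbT.
case: ifP => [ms|_]; last by rewrite mulr0.
rewrite spikeE // eqxx /sigma.
have -> : m%:~R * h + r * h - (s%:~R * h + h) =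
    ((absz (m - s))%:R + r - 1) * h.
  rewrite -[(absz _)%:R]/((absz (m - s))%:Z%:~R) gez0_abs ?subr_ge0 // intrB; ring.
rewrite mulrA mulrA hfact_hsum_coef // (_ : r + 1 = r - 1 + 1 + 1); last by ring.
rewrite !(@powRD _ h _ 1) ?hN0 ?implybT // !powRr1 ?(ltW h0) //; ring.
Qed.

Lemma powRS h r : 0 < h -> h `^ (r + 1) = h `^ r * h.
Proof. by move=> h0; rewrite powRD ?(gt_eqF h0) ?implybT // powRr1 // ltW. Qed.

Lemma sigma_int h s : sigma h (s%:~R * h) = (s + 1)%:~R * h.
Proof. by rewrite /sigma intrD mulrDl mul1r. Qed.

(** At s = m - 1 the sum jumps from 0 to its first value, whence the extra
    case. *)
Lemma left_hdiff_spike h alpha p m s : 0 < h -> alpha <= 1 -> p <= m ->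
  left_hdiff h (p%:~R * h) alpha (spike h m) (s%:~R * h) =
  h `^ (1 - alpha) *
    (if m <= s then hsum_coef (1 - alpha) (absz (s - m)).+1
                    - hsum_coef (1 - alpha) (absz (s - m))
     else (s + 1 == m)%:R).
Proof.
move=> h0 alpha1 pm; have hN0 : h != 0 by rewrite gt_eqF.
rewrite /left_hdiff /hdelta sigma_int !left_hsum_spike ?subr_ge0 // powRS //.
case: (leP m s) => [ms|sm].
  rewrite ifT; last by lia.
  have -> : absz (s + 1 - m)%R = (absz (s - m)).+1 by lia.
  by field.
case: eqVneq => [<-|sm1]; first by rewrite lexx subrr hsum_coef0 /=; field.
by rewrite ifF; [rewrite subrr mul0r mulr0|lia].
Qed.

Lemma right_hdiff_spike h beta (q m s : int) : 0 < h -> beta <= 1 -> m <= q ->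
  right_hdiff h (q%:~R * h) beta (spike h m) (s%:~R * h) =
  h `^ (1 - beta) *
    (if s < m then hsum_coef (1 - beta) (absz (m - s))
                   - hsum_coef (1 - beta) (absz (m - s)).-1
     else (s == m)%:R).
Proof.
move=> h0 beta1 mq; have hN0 : h != 0 by rewrite gt_eqF.
rewrite /right_hdiff /hdelta sigma_int !right_hsum_spike ?subr_ge0 // powRS //.
case: (ltP s m) => [sm|ms].
  rewrite !ifT; [|by lia|by lia].
  have -> : absz (m - (s + 1))%R = (absz (m - s)).-1 by lia.
  by field.
rewrite ifF; last by lia.
case: eqVneq => [->|sm1]; first by rewrite lexx subrr hsum_coef0 /=; field.
by rewrite ifF; [rewrite subrr mul0r oppr0 mulr0|lia].
Qed.

End spike.

(** * The second variation *)

Section necessary_condition.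
Context {R : realType}.
Implicit Types (h a b alpha beta : R) (f y eta : R -> R) (L : R -> R -> R -> R -> R).

Definition second_variation h a b alpha beta L y eta t : R :=
  quadratic_form (L t)
    (y (sigma h t)) (left_hdiff h a alpha y t) (right_hdiff h b beta y t)
    (eta (sigma h t)) (left_hdiff h a alpha eta t) (right_hdiff h b beta eta t).

Lemma finite_Tkappa h a b : 0 < h -> finite_set (Tkappa h a b).
Proof.
move=> h0.
apply: (@sub_finite_set _ _ ((fun k : int => k%:~R * h) @`
   [set k : int | a / h <= k%:~R <= (b - h) / h])); last first.
  exact/finite_image/finite_int_itv.
move=> _ [[k ->] /andP[ak kb]]; exists k => //=.
by rewrite ler_pdivrMr // ler_pdivlMr // ak.
Qed.

(** The supremum ranges over a finite set, so the sum of the values bounds it. *)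
Lemma max_TkappaZ_le h a b f : 0 < h ->
  exists2 M, 0 <= M & forall e, max_Tkappa h a b (fun x => e * f x) <= `|e| * M.
Proof.
move=> h0; have Tfin := finite_Tkappa _ a b h0.
pose M := \sum_(x \in Tkappa h a b) `|f x|.
have M0 : 0 <= M by apply: fsumr_ge0.
exists M => // e; rewrite /max_Tkappa.
set S := [set _ | _ in _].
have [->|S0] := eqVneq S set0; first by rewrite sup0 mulr_ge0.
apply: ge_sup; first exact/set0P.
move=> _ [x Tx <-]; rewrite normrM ler_wpM2l // /M (fsbigD1 x) //= lerDl.
exact: fsumr_ge0.
Qed.

Lemma hnormZ_le h a b alpha beta eta : 0 < h ->
  exists2 M, 0 <= M &
    forall e, hnorm h a b alpha beta (fun x => e * eta x) <= `|e| * M.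
Proof.
move=> h0.
have [M1 M10 M1P] := max_TkappaZ_le _ a b (eta \o sigma h) h0.
have [M2 M20 M2P] := max_TkappaZ_le _ a b (left_hdiff h a alpha eta) h0.
have [M3 M30 M3P] := max_TkappaZ_le _ a b (right_hdiff h b beta eta) h0.
exists (M1 + M2 + M3); first by rewrite !addr_ge0.
move=> e; rewrite /hnorm !mulrDr.
have -> : left_hdiff h a alpha (fun x => e * eta x) =
  fun x => e * left_hdiff h a alpha eta x.
  by apply/funext => x; rewrite left_hdiffZ.
have -> : right_hdiff h b beta (fun x => e * eta x) =
  fun x => e * right_hdiff h b beta eta x.
  by apply/funext => x; rewrite right_hdiffZ.
by apply: lerD; [apply: lerD; [exact: M1P|exact: M2P]|exact: M3P].
Qed.

(** A finite sum of the expansions of L(s, .), the arguments being affine in e by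
    linearity of the fractional differences. *)
Lemma functional_expansion h (p : int) (n : nat) alpha beta L y eta :
  let a := p%:~R * h in let b := (p + n%:Z)%:~R * h in
  0 < h -> (forall t, Tkappa h a b t -> second_order_C (L t)) ->
  exists C l : R, exists2 q : R -> R,
    q e @[e --> 0] --> hint h a b (second_variation h a b alpha beta L y eta) &
    forall e, functional h a b alpha beta L (fun x => y x + e * eta x) =
      C + e * l + e ^+ 2 / 2 * q e.
Proof.
move=> a b h0 LC; pose x (i : 'I_n) : R := (p + (i : nat)%:Z)%:~R * h.
have LxC i : second_order_C (L (x i)).
  apply: LC; split; first by exists (p + (i : nat)%:Z).
  rewrite /x /a /b -[X in _ - X]mul1r -mulrBl -(intrB _ _ 1).
  rewrite !ler_pM2r // !ler_int; have := ltn_ord i; lia.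
have /choice[q qP] : forall i : 'I_n, exists q : R -> R,
    q e @[e --> 0] --> second_variation h a b alpha beta L y eta (x i) /\
    forall e, along h a b alpha beta L (fun z => y z + e * eta z) (x i) =
      along h a b alpha beta L y (x i)
      + e * (along h a b alpha beta (fun t => pu (L t)) y (x i)
               * eta (sigma h (x i))
             + along h a b alpha beta (fun t => pv (L t)) y (x i)
               * left_hdiff h a alpha eta (x i)
             + along h a b alpha beta (fun t => pw (L t)) y (x i)
               * right_hdiff h b beta eta (x i))
      + e ^+ 2 / 2 * q e.
  move=> i; have [q qc qE] := second_order_expansion _
    (y (sigma h (x i))) (left_hdiff h a alpha y (x i))
    (right_hdiff h b beta y (x i)) (eta (sigma h (x i)))
    (left_hdiff h a alpha eta (x i)) (right_hdiff h b beta eta (x i)) (LxC i).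
  exists q; split=> // e; rewrite -qE /along.
  by rewrite left_hdiffD left_hdiffZ right_hdiffD right_hdiffZ.
pose l i := along h a b alpha beta (fun t => pu (L t)) y (x i)
               * eta (sigma h (x i))
             + along h a b alpha beta (fun t => pv (L t)) y (x i)
               * left_hdiff h a alpha eta (x i)
             + along h a b alpha beta (fun t => pw (L t)) y (x i)
               * right_hdiff h b beta eta (x i).
exists (\sum_(i < n) along h a b alpha beta L y (x i) * h).
exists (\sum_(i < n) l i * h), (fun e => \sum_(i < n) q i e * h).
  rewrite hint_nat //; apply: cvg_big => [|i _].
    by move=> z; exact: add_continuous.
  by apply: cvgM; [case: (qP i)|exact: cvg_cst].
move=> e; rewrite /functional hint_nat // !mulr_sumr -!big_split /=.
apply: eq_bigr => i _; have [_ ->] := qP i.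
by rewrite 2!mulrDl -!mulrA.
Qed.

(** On the finite set T^kappa the norm of e * eta is O(e), so yhat + e * eta is an
    admissible competitor for all small e. *)
Lemma second_variation_ge0 h (p : int) (n : nat) alpha beta L A B y eta :
  let a := p%:~R * h in let b := (p + n%:Z)%:~R * h in
  0 < h -> (forall t, Tkappa h a b t -> second_order_C (L t)) ->
  local_minimum h a b alpha beta L A B y -> eta a = 0 -> eta b = 0 ->
  0 <= hint h a b (second_variation h a b alpha beta L y eta).
Proof.
move=> a b h0 LC [ya yb [delta delta0 ymin]] eta_a eta_b.
have [C [l [q qQ phiE]]] :=
  functional_expansion h p n alpha beta L y eta h0 LC.
pose phi e := functional h a b alpha beta L (fun x => y x + e * eta x).
have phi0 : phi 0 = functional h a b alpha beta L y.
  by rewrite /phi; congr functional; apply/funext => x; rewrite mul0r addr0.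
apply: (expansion_at_min_ge0 phi q l _ qQ).
  by move=> e; rewrite /phi !phiE mul0r expr0n /= !mul0r !addr0.
have [M M0 MP] := hnormZ_le h a b alpha beta eta h0.
have M1 : 0 < M + 1 by rewrite ltr_wpDl.
apply: (@filterS _ _ _ _ _ _ (@pseudometric_normed_Zmodule.nbhs0_lt R R _ (divr_gt0 delta0 M1))) => e.
rewrite ltr_pdivlMr // => eM; rewrite phi0; apply: ymin.
- by rewrite eta_a mulr0 addr0.
- by rewrite eta_b mulr0 addr0.
have -> : (fun x => y x + e * eta x) \- y = fun x => e * eta x.
  by apply/funext => x /=; ring.
apply: le_lt_trans (MP e) _; apply: le_lt_trans eM.
by rewrite ler_wpM2l // lerDl.
Qed.

Lemma hpow_add2 h r : 0 < h -> h `^ r = h `^ (r - 2) * h ^+ 2.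
Proof.
move=> h0; rewrite expr2 mulrA -!powRS //; congr (_ `^ _); ring.
Qed.

Lemma hpow_double h r : 0 < h -> h `^ (2 * r) = (h `^ r) ^+ 2.
Proof.
by move=> h0; rewrite mulr_natl mulr2n powRD ?(gt_eqF h0) ?implybT.
Qed.

Lemma spike_at_sigma h (m s : int) : 0 < h ->
  spike h m (sigma h (s%:~R * h)) = if s + 1 == m then h else 0.
Proof. by move=> h0; rewrite sigma_int spikeE. Qed.

Section spike_variation.
Variables (h alpha beta : R) (p k q : int) (L : R -> R -> R -> R -> R).
Variable y : R -> R.
Hypotheses (h0 : 0 < h) (alpha1 : alpha <= 1) (beta1 : beta <= 1).
Hypotheses (pk : p <= k) (kq : k + 2 <= q).

Local Notation V := (second_variation h (p%:~R * h) (q%:~R * h) alpha beta L y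
  (spike h (k + 1))).
Local Notation along_y G := (along h (p%:~R * h) (q%:~R * h) alpha beta G y).

(** The shifted spike and its left difference vanish here, so one square remains.
    The factorial function of order nu - 2 produces h^(nu - 2) instead of h^nu,
    which the factors h and h^3 compensate after squaring. *)
Lemma second_variation_before s : s < k ->
  V (s%:~R * h) = h * (h ^+ 3 * along_y (fun t => pw (pw (L t))) (s%:~R * h) *
    ((1 - beta) * (1 - (1 - beta)) / Gamma (1 - beta + 1)
     * hfact h (k%:~R * h + (1 - beta) * h - sigma h (s%:~R * h))
         (1 - beta - 2)) ^+ 2).
Proof.
move=> sk; rewrite /second_variation /quadratic_form spike_at_sigma //.
rewrite left_hdiff_spike // ?right_hdiff_spike //; try lia.
rewrite ifF; last by lia.
rewrite ifF; last by lia.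
rewrite ifT; last by lia.
have -> : (s + 1 == k + 1) = false by lia.
have -> : absz (k + 1 - s)%R = (absz (k - s - 1)%R).+2 by lia.
have -> : k%:~R * h + (1 - beta) * h - sigma h (s%:~R * h) =
    ((absz (k - s - 1)%R)%:R + (1 - beta)) * h.
  rewrite -[(absz _)%:R]/((absz (k - s - 1)%R)%:Z%:~R) gez0_abs; last by lia.
  by rewrite /sigma !intrB; ring.
have := hfact_hsum_coefB _ (1 - beta) (absz (k - s - 1)%R) h0.
rewrite subr_ge0 => /(_ beta1) E.
rewrite (_ : _ / _ * hfact _ _ _ = - (h `^ (1 - beta - 2) *
  (hsum_coef (1 - beta) (absz (k - s - 1)%R).+2
   - hsum_coef (1 - beta) (absz (k - s - 1)%R).+1))); last first.
  by rewrite -E; ring.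
rewrite (hpow_add2 _ (1 - beta)) // /along /=.
(* What remains is a polynomial identity in the derivatives and the powers of
   h. *)
move: (pw (pw _) _ _ _) (pw (pv _) _ _ _) (pw (pu _) _ _ _).
move: (pv (pv _) _ _ _) (pv (pu _) _ _ _) (pu (pu _) _ _ _).
move: (h `^ _) (hsum_coef _ _) (hsum_coef _ _) (h `^ _) => *.
by ring.
Qed.

(** The mirror case: here the shifted spike and its right difference vanish. *)
Lemma second_variation_after s : k + 2 <= s < q ->
  V (s%:~R * h) = h * (h ^+ 3 * along_y (fun t => pv (pv (L t))) (s%:~R * h) *
    ((1 - alpha) * (1 - alpha - 1) / Gamma (1 - alpha + 1)
     * hfact h (s%:~R * h + (1 - alpha) * h - sigma h (sigma h (k%:~R * h)))
         (1 - alpha - 2)) ^+ 2).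
Proof.
move=> ks; rewrite /second_variation /quadratic_form spike_at_sigma //.
rewrite left_hdiff_spike // ?right_hdiff_spike //; try lia.
rewrite ifF; last by lia.
rewrite ifT; last by lia.
rewrite ifF; last by lia.
have -> : (s == k + 1) = false by lia.
have -> : absz (s - (k + 1))%R = (absz (s - k - 2)%R).+1 by lia.
have -> : s%:~R * h + (1 - alpha) * h - sigma h (sigma h (k%:~R * h)) =
    ((absz (s - k - 2)%R)%:R + (1 - alpha)) * h.
  rewrite -[(absz _)%:R]/((absz (s - k - 2)%R)%:Z%:~R) gez0_abs; last by lia.
  by rewrite /sigma !intrB; ring.
rewrite hfact_hsum_coefB ?subr_ge0 //.
rewrite (hpow_add2 _ (1 - alpha)) // /along /=.
move: (pw (pw _) _ _ _) (pw (pv _) _ _ _) (pw (pu _) _ _ _).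
move: (pv (pv _) _ _ _) (pv (pu _) _ _ _) (pu (pu _) _ _ _).
move: (h `^ _) (hsum_coef _ _) (hsum_coef _ _) (h `^ _) => *.
by ring.
Qed.

Lemma second_variation_at :
  let t := k%:~R * h in
  V t = h ^+ 2 * along_y (fun t => pu (pu (L t))) t
    + 2 * h `^ (1 - alpha + 1) * along_y (fun t => pv (pu (L t))) t
    + 2 * h `^ (1 - beta + 1) * (1 - beta - 1)
        * along_y (fun t => pw (pu (L t))) t
    + 2 * h `^ (1 - beta + (1 - alpha)) * (1 - beta - 1)
        * along_y (fun t => pw (pv (L t))) t
    + h `^ (2 * (1 - beta)) * (1 - beta - 1) ^+ 2
        * along_y (fun t => pw (pw (L t))) t
    + h `^ (2 * (1 - alpha)) * along_y (fun t => pv (pv (L t))) t.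
Proof.
move=> t; rewrite /second_variation /quadratic_form spike_at_sigma //.
rewrite left_hdiff_spike // ?right_hdiff_spike //; try lia.
rewrite eqxx ifF; last by lia.
rewrite ifT; last by lia.
have -> : absz (k + 1 - k)%R = 1%N by lia.
rewrite hsum_coef1 hsum_coef0 !hpow_double // !powRS //.
rewrite (powRD (r := 1 - beta)) ?(gt_eqF h0) ?implybT //.
rewrite /along /=.
move: (pw (pw _) _ _ _) (pw (pv _) _ _ _) (pw (pu _) _ _ _).
move: (pv (pv _) _ _ _) (pv (pu _) _ _ _) (pu (pu _) _ _ _).
move: (h `^ (1 - alpha)) (h `^ (1 - beta)) => *.
by ring.
Qed.

Lemma second_variation_at_sigma :
  let t := (k + 1)%:~R * h in
  V t = h `^ (2 * (1 - alpha)) * (1 - alpha - 1) ^+ 2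
        * along_y (fun t => pv (pv (L t))) t
    + 2 * h `^ (1 - beta + (1 - alpha)) * (1 - alpha - 1)
        * along_y (fun t => pw (pv (L t))) t
    + h `^ (2 * (1 - beta)) * along_y (fun t => pw (pw (L t))) t.
Proof.
move=> t; rewrite /second_variation /quadratic_form spike_at_sigma //.
rewrite left_hdiff_spike // ?right_hdiff_spike //; try lia.
rewrite ifF; last by lia.
rewrite lexx ltxx eqxx subrr hsum_coef1 hsum_coef0 !hpow_double //.
rewrite (powRD (r := 1 - beta)) ?(gt_eqF h0) ?implybT //.
rewrite /along /=.
move: (pw (pw _) _ _ _) (pw (pv _) _ _ _) (pw (pu _) _ _ _).
move: (pv (pv _) _ _ _) (pv (pu _) _ _ _) (pu (pu _) _ _ _).
move: (h `^ (1 - alpha)) (h `^ (1 - beta)) => *.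
by ring.
Qed.

End spike_variation.
End necessary_condition.

(** * The necessary condition *)

(* The coefficient of Lvv t is h^(2 gamma), the square of the left fractional
   difference at t of the variation equal to h at t + h and 0 elsewhere; the
   source prints h^gamma, for which the inequality fails in general. *)
Theorem theorem154 (R : realType) (h a b alpha beta : R)
    (L : R -> R -> R -> R -> R) (A B : R) (yhat : R -> R) :
  0 < h -> hZ h a -> hZ h b -> a < b ->
  0 < alpha <= 1 -> 0 < beta <= 1 ->
  (forall t, Tkappa h a b t -> second_order_C (L t)) ->
  local_minimum h a b alpha beta L A B yhat ->
  forall t, Tkappa2 h a b t ->
  let gamma := 1 - alpha in
  let nu := 1 - beta in
  let s1 := sigma h t in
  let s2 := sigma h (sigma h t) in
  let at_yhat G := along h a b alpha beta G yhat in
  let Luu := at_yhat (fun t => pu (pu (L t))) in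
  let Luv := at_yhat (fun t => pv (pu (L t))) in
  let Luw := at_yhat (fun t => pw (pu (L t))) in
  let Lvv := at_yhat (fun t => pv (pv (L t))) in
  let Lvw := at_yhat (fun t => pw (pv (L t))) in
  let Lww := at_yhat (fun t => pw (pw (L t))) in
  0 <= h ^+ 2 * Luu t
       + 2 * h `^ (gamma + 1) * Luv t
       + 2 * h `^ (nu + 1) * (nu - 1) * Luw t
       + h `^ (2 * gamma) * (gamma - 1) ^+ 2 * Lvv s1
       + 2 * h `^ (nu + gamma) * (gamma - 1) * Lvw s1
       + 2 * h `^ (nu + gamma) * (nu - 1) * Lvw t
       + h `^ (2 * nu) * (nu - 1) ^+ 2 * Lww t
       + h `^ (2 * nu) * Lww s1
       + hint h a t (fun s => h ^+ 3 * Lww s *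
           (nu * (1 - nu) / Gamma (nu + 1)
            * hfact h (t + nu * h - sigma h s) (nu - 2)) ^+ 2)
       + h `^ (2 * gamma) * Lvv t
       + hint h s2 b (fun s => h ^+ 3 * Lvv s *
           (gamma * (gamma - 1) / Gamma (gamma + 1)
            * hfact h (s + gamma * h - s2) (gamma - 2)) ^+ 2).
Proof.
move=> h0 [p ->] [q ->] ab /andP[alpha0 alpha1] /andP[beta0 beta1] LC ymin.
move=> t [[k ->] /andP[]]; rewrite ler_pM2r // ler_int => pk.
rewrite -mulrBl -(intrB _ _ 2) ler_pM2r // ler_int => kq.
have {}kq : k + 2 <= q by lia.
have qE : q = p + (absz (q - p)%R)%:Z by lia.
have V0 : 0 <= hint h (p%:~R * h) (q%:~R * h)
    (second_variation h (p%:~R * h) (q%:~R * h) alpha beta L yhat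
       (spike h (k + 1))).
  move: LC ymin; rewrite qE => LC ymin.
  apply: (second_variation_ge0 _ _ _ _ _ _ A B) => //.
    by rewrite spikeE // ifF //; lia.
  by rewrite spikeE // ifF //; lia.
move: V0.
(* Split the sum into the points before t, the point t, the point sigma t, and
   the points from sigma (sigma t) on. *)
rewrite (hint_cat _ p k) //; last by lia.
rewrite (hint_cat _ k (k + 1)) //; [|by lia|by lia].
rewrite (hint_cat _ (k + 1) (k + 1 + 1)) //; [|by lia|by lia].
rewrite !hint1 // second_variation_at // second_variation_at_sigma //.
set before := hint _ _ (k%:~R * h) _; set after := hint _ _ (q%:~R * h) _.
move=> V0; cbv zeta beta.
set beforeL := hint _ _ (k%:~R * h) _; set afterL := hint _ _ (q%:~R * h) _.
have beforeE : before = h * beforeL.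
  apply: eq_hint => // s /andP[_ sk].
  by rewrite second_variation_before.
have afterE : after = h * afterL.
  rewrite /after /afterL !sigma_int.
  apply: eq_hint => // s ks; rewrite second_variation_after //; last by lia.
  by rewrite !sigma_int.
move: V0; rewrite beforeE afterE -sigma_int.
move: beforeL afterL beforeE afterE => X Y _ _.
repeat match goal with |- context [along ?h' ?a ?b ?al ?be ?G ?y ?s] =>
  generalize (along h' a b al be G y s) end.
do 9 move=> ?; move=> V0.
(* The second variation is h times the claimed expression. *)
rewrite -(pmulr_rge0 _ h0); apply: le_trans V0 _; rewrite le_eqVlt.
by apply/orP; left; apply/eqP; ring.
Qed.
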